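(* Let $p$ be a prime. Assume $\Gamma$ is a finite group such that $\Gamma=O^{p'}(\Gamma)$, and let $A$ be a finite faithful $\mathbb F_p\Gamma$-module. Assume there is a saturated fusion system $\mathcal F$ over a finite $p$-group $S$ that realizes $(\Gamma,A)$. Then there are $m\ge1$ and an elementary abelian $p$-subgroup $B\le\Gamma$ of rank $m$ such that $\mathscr J_A(\tau)\le m$ for each $1\ne\tau\in B$.
   Context: Fusion systems. For a finite $p$-group $S$, a fusion system $\mathcal{F}$ over $S$ is a category whose objects are the subgroups of $S$, whose morphisms are injective homomorphisms (with the usual composition), such that for all $P,Q\le S$ the set $\mathrm{Hom}_{\mathcal F}(P,Q)$ contains all maps $x\mapsto gxg^{-1}$ for $g\in S$ with $gPg^{-1}\le Q$, and such that every morphism is the composite of an $\mathcal F$-isomorphism followed by an inclusion. Subgroups isomorphic in $\mathcal F$ are called $\mathcal F$-conjugate. A subgroup $P\le S$ is fully normalized (fully centralized) if $|N_S(P)|\ge|N_S(Q)|$ (resp. $|C_S(P)|\ge|C_S(Q)|$) for every $Q$ that is $\mathcal F$-conjugate to $P$. $\mathcal F$ is saturated if (1) each fully normalized $P$ is fully centralized and $\mathrm{Aut}_S(P)\in\mathrm{Syl}_p(\mathrm{Aut}_{\mathcal F}(P))$; and (2) each $\varphi\in\mathrm{Iso}_{\mathcal F}(P,Q)$ with $Q$ fully centralized extends to a morphism in $\mathrm{Hom}_{\mathcal F}(N_\varphi,S)$, where $N_\varphi=\{g\in N_S(P)\mid \varphi c_g\varphi^{-1}\in\mathrm{Aut}_S(Q)\}$.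 Here $c_g(x)=gxg^{-1}$, and $\mathrm{Aut}_S(P)$ is the group of automorphisms of $P$ induced by conjugation by elements of $N_S(P)$. A subgroup $P\le S$ is normal in $\mathcal F$ if each morphism in $\mathrm{Hom}_{\mathcal F}(Q,R)$ extends to a morphism in $\mathrm{Hom}_{\mathcal F}(QP,RP)$ that sends $P$ to itself. Realizability. For a finite abelian $p$-group $A$ and $\Gamma\le\mathrm{Aut}(A)$, the pair $(\Gamma,A)$ is realized by a saturated fusion system $\mathcal F$ over a finite $p$-group $S$ if there is an abelian subgroup $A'\le S$ such that $C_S(A')=A'$, $A'$ is not normal in $\mathcal F$, and $(\mathrm{Aut}_{\mathcal F}(A'),A')\cong(\Gamma,A)$. A faithful $\mathbb F_p\Gamma$-module is regarded as an elementary abelian $p$-group $A$ with $\Gamma\le\mathrm{Aut}(A)$. Notation. $O^{p'}(\Gamma)$ is the smallest normal subgroup of $\Gamma$ of index prime to $p$. For an elementary abelian $p$-group $A$ and $\tau\in\mathrm{Aut}(A)$ of $p$-power order, $\mathscr J_A(\tau)=\mathrm{rk}(C_A(\tau)\cap[\tau,A])$, where $[\tau,A]=\{\tau(a)-a\mid a\in A\}$; this is the number of Jordan blocks of $\tau$ on $A$ with nontrivial action. *)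

(* Defs.v *)
From HB Require Import structures.
From mathcomp Require Import all_boot all_order all_fingroup all_algebra.
From mathcomp Require Import all_solvable all_field all_character.

Set Implicit Arguments.
Unset Strict Implicit.
Unset Printing Implicit Defensive.

Import GroupScope.

Section PartialMaps.

Variable gT : finGroupType.
Implicit Types (P Q R : {group gT}) (f g : {ffun gT -> gT}).

(* A homomorphism with domain P is represented by the function on the whole   *)
(* of gT that takes the value 1 outside P, so that two homomorphisms with the *)
(* same domain are equal iff they agree on that domain, and so that fcomp is  *)
(* the composition of P -> Q with Q -> R.                                     *)
Definition on_dom (P : {set gT}) (h : gT -> gT) : {ffun gT -> gT} :=
  [ffun x => if x \in P then h x else 1].

Definition fcomp g f : {ffun gT -> gT} := [ffun x => g (f x)].

Definition is_injhom P Q f :=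
  [&& f \in pffun_on 1 P Q, morphic P f & dinjectiveb f P].

(* The inclusion of P in any overgroup; the identity of P when that is P.     *)
Definition fincl P := on_dom P id.

(* The invertible elements of H P Q in the category with hom-sets H.          *)
Definition iso_of (H : {group gT} -> {group gT} -> {set {ffun gT -> gT}}) P Q :=
  [set f in H P Q | [exists g in H Q P,
     (fcomp g f == fincl P) && (fcomp f g == fincl Q)]].

End PartialMaps.

(* Hom-sets are indexed by all subgroups of gT, but are empty unless both are *)
(* subgroups of S. Since x ^ g is g^-1 * x * g, the map in fus_conj is        *)
(* conjugation by g^-1; the condition ranges over all g in S, so that the     *)
(* side on which one conjugates does not matter.                              *)
Record fusion_system (gT : finGroupType) (S : {group gT}) := FusionSystem {
  fusHom :> {group gT} -> {group gT} -> {set {ffun gT -> gT}};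
  fusHomP : forall (P Q : {group gT}) f, f \in fusHom P Q ->
    [/\ P \subset S, Q \subset S & is_injhom P Q f];
  fus_conj : forall (P Q : {group gT}) (g : gT),
    P \subset S -> Q \subset S -> g \in S -> P :^ g \subset Q ->
    on_dom P (conjg^~ g) \in fusHom P Q;
  fus_comp : forall (P Q R : {group gT}) f g,
    f \in fusHom P Q -> g \in fusHom Q R -> fcomp g f \in fusHom P R;
  fus_factor : forall (P Q : {group gT}) f, f \in fusHom P Q ->
    exists (R : {group gT}) (f0 : {ffun gT -> gT}),
      [/\ R \subset Q, f0 \in iso_of fusHom P R & f = fcomp (fincl R) f0]
}.

Section Fusion.

Variables (gT : finGroupType) (S : {group gT}) (F : fusion_system S).
Implicit Types (P Q R : {group gT}) (f : {ffun gT -> gT}).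

Definition fusIso P Q := iso_of F P Q.

Definition fus_conjugate P Q := exists f, f \in fusIso P Q.

Definition fully_normalized P :=
  forall Q, fus_conjugate P Q -> (#|'N_S(Q)| <= #|'N_S(P)|)%N.

Definition fully_centralized P :=
  forall Q, fus_conjugate P Q -> (#|'C_S(Q)| <= #|'C_S(P)|)%N.

Definition fusAut P : {set {perm gT}} := [set a in Aut P | on_dom P a \in F P P].

Definition autS P : {set {perm gT}} := conj_aut P @* 'N_S(P).

(* The condition on g says that f o c_g o f^-1 is in Aut_S(Q).                *)
Definition fus_ext_dom P Q f : {set gT} :=
  [set g in 'N_S(P) |
     [exists a in autS Q, [forall x in P, f (x ^ g) == a (f x)]]].

Fact fus_ext_dom_group_set P Q f : group_set (fus_ext_dom P Q f).
Proof.
apply/group_setP; split=> [|g h].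
  rewrite inE group1; apply/existsP; exists 1; rewrite group1 /=.
  by apply/forall_inP=> x _; rewrite conjg1 perm1.
move=> /[1!inE] /andP[Ng /exists_inP[a Aa /forall_inP Ha]].
move=> /[1!inE] /andP[Nh /exists_inP[b Ab /forall_inP Hb]].
rewrite inE groupM //=.
apply/existsP; exists (a * b); rewrite groupM //=.
apply/forall_inP=> x Px; rewrite conjgM permM.
by rewrite (eqP (Hb _ _)) ?(eqP (Ha _ Px)) // memJ_norm //; case/setIP: Ng.
Qed.
Canonical fus_ext_dom_group P Q f := Group (fus_ext_dom_group_set P Q f).

Definition saturated (p : nat) :=
     (forall P, P \subset S -> fully_normalized P ->
        fully_centralized P /\ p.-Sylow(fusAut P) (autS P))
  /\ (forall P Q f, f \in fusIso P Q -> fully_centralized Q ->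
        exists2 g, g \in F (fus_ext_dom_group P Q f) S & {in P, g =1 f}).

(* The join Q <*> P is the product QP: for Q = R = S, the condition implies   *)
(* that P is normalized by S.                                                 *)
Definition fus_normal P :=
  P \subset S /\
  forall Q R f, f \in F Q R ->
    exists2 g, g \in F (Q <*> P)%G (R <*> P)%G
             & {in Q, g =1 f} /\ g @: P = P.

Fact fusAut_group_set P : P \subset S -> group_set (fusAut P).
Proof.
move=> sPS; apply/group_setP; split=> [|a b].
  rewrite inE group1 /=.
  have -> : on_dom P (1 : {perm gT}) = on_dom P (conjg^~ 1).
    by apply/ffunP=> x; rewrite !ffunE perm1 conjg1.
  by apply: fus_conj; rewrite ?conjsg1.
move=> /[1!inE] /andP[Aa Fa] /[1!inE] /andP[Ab Fb].
rewrite inE groupM //=.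
have -> : on_dom P (a * b) = fcomp (on_dom P b) (on_dom P a).
  apply/ffunP=> x; rewrite !ffunE; case: ifP => Px.
    by rewrite permM Aut_closed.
  by rewrite group1 -(autmE Ab) morph1.
exact: fus_comp Fa Fb.
Qed.

(* (Aut_F(A'), A') is isomorphic to (G, A), where to is the action of G on A. *)
(* The isomorphism G -> Aut_F(A') makes this false for an action that is not  *)
(* faithful.                                                                  *)
Definition realizes (aT rT : finGroupType) (G : {group aT}) (A : {group rT})
    (to : groupAction G A) :=
  exists A' : {group gT},
  [/\ A' \subset S, abelian A', 'C_S(A') = A', ~ fus_normal A'
    & exists (phi : {morphism G >-> {perm gT}}) (chi : {morphism A >-> gT}),
      [/\ isom G (fusAut A') phi, isom A A' chi
        & {in A & G, morph_act to 'P chi phi}]].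

End Fusion.

(* O^{p'}(G), the smallest normal subgroup of G of index prime to p.          *)
Definition pprime_residual (p : nat) (aT : finGroupType) (G : {group aT}) :=
  \bigcap_(N : {group aT} | (N <| G) && coprime p #|G : N|) N.

(* rk(C_A(t) :&: [t, A]); the row space of rG t - 1 is {t(a) - a | a in A}.   *)
Definition jordan_blocks (K : fieldType) (aT : finGroupType) (G : {group aT})
    (n : nat) (rG : mx_representation K G n) (t : aT) : nat :=
  \rank (rfix_mx rG [set t] :&: (rG t - 1%:M)%R)%MS.

(* Main.v *)
Require Import Defs.
From mathcomp Require Import all_boot all_order all_fingroup all_algebra.
From mathcomp Require Import all_solvable all_field all_character.

(* Write A for the elementary abelian subgroup of S with Aut_F(A) = G. It is  *)
(* enough to find an elementary abelian X <= N_S(A), not contained in A, with *)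
(* |C_A(x) :&: [A, x]| <= |X : X :&: A| for all x in X outside A: the image B *)
(* of X in Aut_F(A) then has rank m = rk (X / X :&: A).                       *)
(* If N_S(A) contains an elementary abelian E <> A of the same order as A,    *)
(* then X = E works, since [A, x] has order |A : C_A(x)| <= |A : E :&: A|.    *)
(* Otherwise A is normal in S and weakly closed, and, not being normal in F,  *)
(* is not strongly closed: some X not contained in A is mapped into A by F.   *)
(* Choose X with |X :&: A|, and then |X|, maximal. For x in X outside A and   *)
(* Z = X :&: A, let Y be the set of a in A with [a, x] in Z. It normalizes    *)
(* P = Z<x>, so it is in the domain of a morphism N_S(P) -> S that maps P to  *)
(* a fully normalized subgroup, and maximality of X, applied to the images of *)
(* X and Y, gives |Y| <= |X|. Since Y contains C_A(x), whose intersection     *)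
(* with [A, x] meets Z in at most [Y, x], |C_A(x) :&: [A, x]| <= |Y : Z|.     *)

Set Implicit Arguments.
Unset Strict Implicit.
Unset Printing Implicit Defensive.

Import GroupScope.

(** Everything takes place in [S]: for a suitable elementary abelian [X <= N_S(A)], the group [B]
    consists of the elements of [G] that act on [A] as elements of [X]. Then |B| = |X : X :&: A|, so
    the theorem amounts to bounding |C_A(x) :&: [A, x]| by this index, which is [jordan_bound]. Such
    an [X] exists by [exists_jordan_bound]. A second elementary abelian subgroup of order |A| in
    N_S(A) works by a count ([jordan_bound_same_order]). When there is none, every morphism defined
    on [A] preserves [A]. Since an abelian strongly closed subgroup would be normal
    ([strongly_closed_normal]), some subgroup outside [A] is mapped into [A], and a maximal one
    works ([jordan_bound_fused]). Two facts carry the last case: the inequality [card_cent_comm_by],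
    and [normalizer_extend], which moves a subgroup together with its normalizer to a fully
    normalized conjugate. *)

(** * Calculus of morphisms in a fusion system *)

Section FusionMaps.

Variables (gT : finGroupType) (S : {group gT}) (F : fusion_system S).
Implicit Types (P Q R A : {group gT}) (h k : gT -> gT).

(** Only the values of [h] on [P] matter, so composites and restrictions of morphisms can be written
    with plain functions. *)
Definition fhom P Q h := on_dom P h \in F P Q.

Lemma on_domE P h x : x \in P -> on_dom P h x = h x.
Proof. by rewrite ffunE => ->. Qed.

Lemma eq_fhom P Q h k : {in P, h =1 k} -> fhom P Q h -> fhom P Q k.
Proof.
move=> hk; rewrite /fhom; suff -> : on_dom P h = on_dom P k by [].
by apply/ffunP=> x; rewrite !ffunE; case: ifP => // /hk.
Qed.

Lemma fhomP P Q h : fhom P Q h ->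
  [/\ P \subset S, Q \subset S, {in P, forall x, h x \in Q},
      {in P &, {morph h : x y / x * y}} & {in P &, injective h}].
Proof.
move=> /fusHomP[sPS sQS /and3P[/pffun_onP[_ hQ] /morphicP hM /dinjectiveP hI]].
split=> // [x Px|x y Px Py|x y Px Py].
- by rewrite -(on_domE h Px) hQ ?map_f // mem_enum.
- by have := hM x y Px Py; rewrite !on_domE ?groupM.
- by move=> e; apply: hI; rewrite ?on_domE.
Qed.

Lemma mem_fhom P Q (f : {ffun gT -> gT}) : f \in F P Q -> fhom P Q f.
Proof.
move=> Ff; rewrite /fhom; suff -> : on_dom P f = f by [].
have [_ _ /and3P[/pffun_onP[/subsetP sf _] _ _]] := fusHomP Ff.
by apply/ffunP=> x; rewrite ffunE; case: ifPn => // /(contraNN (sf x))/negPn/eqP.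
Qed.

Lemma fhom_morphism P Q h : fhom P Q h ->
  exists2 f : {morphism P >-> gT}, 'injm f & f = h :> (gT -> gT).
Proof.
move=> /fhomP[_ _ _ /morphicP hM hI].
exists (morphm_morphism hM); last by [].
have hI2 : {in P &, injective (morphm hM)} by [].
exact/injmP.
Qed.

Lemma fhom_comp P Q R h k : fhom P Q h -> fhom Q R k -> fhom P R (k \o h).
Proof.
move=> Fh Fk; have [_ _ hQ _ _] := fhomP Fh.
rewrite /fhom; suff <- : fcomp (on_dom Q k) (on_dom P h) = on_dom P (k \o h).
  exact: fus_comp Fh Fk.
apply/ffunP=> x; rewrite !ffunE /=; case Px: (x \in P); first by rewrite hQ.
(* Outside [P] the inner map takes the default value 1, which [k] sends to 1. *)
have [f _ <-] := fhom_morphism Fk.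
by rewrite group1 morph1.
Qed.

Lemma fhom_conj P Q g : P \subset S -> Q \subset S -> g \in S ->
  P :^ g \subset Q -> fhom P Q (conjg^~ g).
Proof. exact: fus_conj. Qed.

Lemma fhom_id P Q : P \subset Q -> Q \subset S -> fhom P Q id.
Proof.
move=> sPQ sQS; apply: (@eq_fhom _ _ (conjg^~ 1)) => [x _|]; first exact: conjg1.
by apply: fhom_conj; rewrite ?conjsg1 // (subset_trans sPQ).
Qed.

Lemma fhom_restr P Q P0 h : P0 \subset P -> fhom P Q h -> fhom P0 Q h.
Proof.
move=> sP Fh; have [sPS _ _ _ _] := fhomP Fh.
exact: (fhom_comp (fhom_id sP sPS) Fh).
Qed.

(** The factorization axiom makes [h] an isomorphism onto its image [R], with inverse [k] in [F]. *)
Lemma fhom_inv P Q h : fhom P Q h ->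
  exists R k, [/\ R = h @: P :> {set gT}, R \subset Q, fhom P R h, fhom R P k
    & {in P, cancel h k} /\ {in R, cancel k h}].
Proof.
move=> Fh; have [R [f [sRQ]]] := fus_factor Fh.
rewrite inE => /andP[Ff /exists_inP[k Fk /andP[/eqP kf /eqP fk]]] def_h.
have [_ _ fR _ _] := fhomP (mem_fhom Ff); have [_ _ kP _ _] := fhomP (mem_fhom Fk).
have hf : {in P, f =1 h}.
  by move=> x Px; rewrite -(on_domE h Px) def_h !ffunE fR.
have hK : {in P, cancel h k}.
  move=> x Px; rewrite -hf //; move/ffunP/(_ x): kf.
  by rewrite !ffunE Px.
have kK : {in R, cancel k h}.
  move=> x Rx; rewrite -hf ?kP //; move/ffunP/(_ x): fk.
  by rewrite !ffunE Rx.
exists R, k; split=> //; [|exact: eq_fhom (mem_fhom Ff)|exact: mem_fhom].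
apply/setP=> y; apply/idP/imsetP=> [Ry | [x Px ->]]; last by rewrite -hf ?fR.
by exists (k y); rewrite ?kP ?kK.
Qed.

Lemma fhom_cod P Q R h : fhom P Q h -> R \subset S -> h @: P \subset R ->
  fhom P R h.
Proof.
move=> Fh sRS; have [R0 [k [<- _ Fh0 _ _]]] := fhom_inv Fh => sR.
exact: (fhom_comp Fh0 (fhom_id sR sRS)).
Qed.

Lemma fhom_iso P Q h : fhom P Q h -> h @: P = Q -> on_dom P h \in fusIso F P Q.
Proof.
move=> Fh imh; have [R [k [defR _ _ Fk [hK kK]]]] := fhom_inv Fh.
have {}defR: R = Q by apply/val_inj; rewrite /= defR.
have [_ _ hQ _ _] := fhomP Fh.
rewrite {R}defR in Fk kK; have [_ _ kP _ _] := fhomP Fk.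
rewrite inE; apply/andP; split; first exact: Fh.
apply/exists_inP; exists (on_dom Q k); first exact: Fk.
apply/andP; split; apply/eqP/ffunP=> x; rewrite !ffunE.
  case Px: (x \in P); first by rewrite hQ ?hK.
  by rewrite group1; have [f _ <-] := fhom_morphism Fk; rewrite morph1.
case Px: (x \in Q); first by rewrite kP ?kK.
by rewrite group1; have [f _ <-] := fhom_morphism Fh; rewrite morph1.
Qed.

Lemma iso_fhom P Q (f : {ffun gT -> gT}) : f \in fusIso F P Q ->
  fhom P Q f /\ f @: P = Q.
Proof.
rewrite inE => /andP[/mem_fhom Ff /exists_inP[k /mem_fhom Fk /andP[_ /eqP fk]]].
split=> //; have [_ _ fQ _ _] := fhomP Ff; have [_ _ kP _ _] := fhomP Fk.
apply/setP=> y; apply/imsetP/idP=> [[x Px ->] | Qy]; first exact: fQ.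
by exists (k y); rewrite ?kP //; move/ffunP/(_ y): fk; rewrite !ffunE Qy.
Qed.

Lemma fhom_aut P h : fhom P P h -> exists2 a, a \in fusAut F P & {in P, a =1 h}.
Proof.
move=> Fh; have [f injf def_f] := fhom_morphism Fh; have [_ _ hP _ _] := fhomP Fh.
have fP : f @* P = P.
  apply/morphim_fixP=> //; apply/subsetP=> _ /morphimP[x _ Px ->].
  by rewrite def_f hP.
exists (aut injf fP); last by move=> x Px; rewrite autE // def_f.
rewrite inE Aut_aut /=; apply: eq_fhom Fh => x Px.
by rewrite autE // def_f.
Qed.

Lemma fusAut_fhom P a : a \in fusAut F P -> fhom P P a.
Proof. by rewrite inE => /andP[]. Qed.

Lemma fusAut_Aut P a : a \in fusAut F P -> a \in Aut P.
Proof. by rewrite inE => /andP[]. Qed.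

Lemma fhom_joing P P0 P1 Q R h : fhom P Q h -> P0 \subset P -> P1 \subset P ->
  h @: P0 \subset R -> h @: P1 \subset R -> h @: (P0 <*> P1) \subset R.
Proof.
move=> Fh sP0 sP1; have [f injf <-] := fhom_morphism Fh.
rewrite -!morphimEsub ?join_subG ?sP0 // => s0 s1.
by rewrite morphimY // join_subG s0.
Qed.

End FusionMaps.

(** * Extending morphisms by saturation *)

Section Saturation.

Variables (p : nat) (gT : finGroupType) (S : {group gT}) (F : fusion_system S).
Hypotheses (pS : p.-group S) (satF : saturated F p).
Implicit Types (P Q R D : {group gT}) (h k : gT -> gT).

(** The domain given by the extension axiom contains [D] by assumption, and [P] because [h] turns
    conjugation by [t] in [P] into conjugation by [h t]. *)
Lemma fhom_extend P Q D h : fhom F P Q h -> h @: P = Q ->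
    fully_centralized F Q -> D \subset 'N_S(P) ->
    (forall t, t \in D ->
       exists2 a, a \in autS S Q & {in P, forall x, h (x ^ t) = a (h x)}) ->
  exists2 k, fhom F (D <*> P)%G S k & {in P, k =1 h}.
Proof.
move=> Fh imh cQ nPD Da; have [sPS sQS hQ hM _] := fhomP Fh.
have [k Fk kh] := satF.2 _ _ _ (fhom_iso Fh imh) cQ.
exists k; last by move=> x Px; rewrite kh // on_domE.
apply: fhom_restr (mem_fhom Fk); rewrite join_subG; apply/andP; split.
  apply/subsetP=> t Dt; have [a Aa ha] := Da t Dt.
  have Nt := subsetP nPD t Dt.
  rewrite inE Nt; apply/exists_inP; exists a => //; apply/forall_inP=> x Px.
  by rewrite !on_domE ?ha // memJ_norm //; case/setIP: Nt.
apply/subsetP=> t Pt; have Nt: t \in 'N_S(P).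
  by rewrite inE (subsetP sPS) ?(subsetP (normG P)).
rewrite inE Nt; apply/exists_inP; exists (conj_aut Q (h t)).
  have Nht: h t \in 'N_S(Q).
    by rewrite inE (subsetP sQS) ?hQ ?(subsetP (normG Q)) ?hQ.
  by apply: mem_morphim (Nht); case/setIP: Nht.
apply/forall_inP=> x Px; rewrite !on_domE ?groupJ // conj_autE ?hQ //.
have [f _ <-] := fhom_morphism Fh; by rewrite morphJ.
Qed.

Lemma fhom_extend_cent P Q h : fhom F P Q h -> h @: P = Q ->
    fully_centralized F Q ->
  exists2 k, fhom F ('C_S(P) <*> P)%G S k & {in P, k =1 h}.
Proof.
move=> Fh imh cQ; apply: (fhom_extend (D := 'C_S(P)%G) Fh imh cQ).
  by rewrite setIS ?cent_sub.
move=> t /setIP[_ cPt]; exists 1; first exact: group1.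
by move=> x Px; rewrite perm1 conjgE -(centP cPt x Px) mulKg.
Qed.

Lemma exists_fully_normalized P : P \subset S ->
  exists Q h, [/\ fhom F P Q h, h @: P = Q & fully_normalized F Q].
Proof.
move=> sPS; pose c Q := [exists f, f \in fusIso F P Q].
have cP : c P.
  apply/existsP; exists (on_dom P id); apply: fhom_iso; first exact: fhom_id.
  exact: imset_id.
have [Q /existsP[f Ff] maxQ] := @arg_maxnP _ P c (fun Q => #|'N_S(Q)|) cP.
have [{}Ff imf] := iso_fhom Ff.
exists Q, f; split=> // R [g /iso_fhom[Fg img]]; apply: maxQ.
apply/existsP; exists (on_dom P (g \o f)); apply: fhom_iso.
  exact: fhom_comp Ff Fg.
by rewrite imset_comp imf.
Qed.

(** The automorphism [a] is conjugation by [t] carried over to [Q] along [h]. *)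
Lemma fhom_transport P Q h t : fhom F P Q h -> h @: P = Q -> t \in 'N_S(P) ->
  exists2 a, a \in fusAut F Q & {in P, forall x, a (h x) = h (x ^ t)}.
Proof.
move=> Fh imh /setIP[St Nt]; have [R [k [defR _ _ Fk [hK kK]]]] := fhom_inv Fh.
have{defR} defR: R = Q by apply/val_inj; rewrite /= defR.
rewrite {R}defR in Fk kK; have [sPS _ hQ _ _] := fhomP Fh.
have Fc: fhom F P P (conjg^~ t) by apply: fhom_conj => //; rewrite (normP Nt).
have [a Aa ak] := fhom_aut (fhom_comp (fhom_comp Fk Fc) Fh).
by exists a => // x Px; rewrite ak ?hQ //= hK.
Qed.

(** Carrying Aut_S(P) over to a fully normalized conjugate [Q] gives a p-subgroup [D] of Aut_F(Q).
    By Sylow, correcting the isomorphism by an element of Aut_F(Q) moves [D] into Aut_S(Q); then all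
    of N_S(P) lies in the extension domain. *)
Lemma normalizer_extend P : P \subset S ->
  exists Q k, [/\ fhom F 'N_S(P)%G S k, k @: P = Q & fully_normalized F Q].
Proof.
move=> sPS; have [Q [h [Fh imh nQ]]] := exists_fully_normalized sPS.
have [_ sQS hQ hM hI] := fhomP Fh.
have [cQ sylQ] := satF.1 _ sQS nQ.
pose D := [set a in fusAut F Q |
  [exists t in 'N_S(P), [forall x in P, a (h x) == h (x ^ t)]]].
have gD : group_set D.
  apply/group_setP; split=> [|a b].
    rewrite inE (group1 (Group (fusAut_group_set F sQS))) /=.
    apply/exists_inP; exists 1 => //; apply/forall_inP=> x Px.
    by rewrite perm1 conjg1.
  move=> /setIdP[Fa /exists_inP[t Nt /forall_inP at_]].
  move=> /setIdP[Fb /exists_inP[u Nu /forall_inP bu]].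
  apply/setIdP; split; first exact: (groupM (G := Group (fusAut_group_set F sQS)) Fa Fb).
  apply/exists_inP; exists (t * u); first exact: groupM.
  apply/forall_inP=> x Px; rewrite permM (eqP (at_ x Px)) conjgM.
  by apply: bu; rewrite memJ_norm //; case/setIP: Nt.
have pD : p.-group (Group gD).
  rewrite -pnat_exponent; apply: (pnat_dvd _ pS); apply/exponentP=> a.
  move=> /setIdP[Fa /exists_inP[t Nt /forall_inP at_]].
  have aX n : {in P, forall x, (a ^+ n) (h x) = h (x ^ (t ^+ n))}.
    elim: n => [|n IHn] x Px; first by rewrite perm1 conjg1.
    rewrite !expgSr permM IHn // conjgM; apply/eqP/at_.
    by rewrite memJ_norm // groupX //; case/setIP: Nt.
  apply: (@eq_Aut _ Q); rewrite ?group1 ?groupX ?(fusAut_Aut Fa) // => y.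
  rewrite -{1}imh => /imsetP[x Px ->]; rewrite aX //.
  case/setIP: Nt => St _; rewrite perm1; congr h.
  have -> : t ^+ #|S| = 1 by apply/eqP; rewrite -order_dvdn order_dvdG.
  exact: conjg1.
have sD : Group gD \subset Group (fusAut_group_set F sQS).
  by apply/subsetP=> a /setIdP[].
have [b Fb sDb] := Sylow_subJ (G := Group (fusAut_group_set F sQS)) sylQ sD pD.
have Fb' : b^-1 \in fusAut F Q by rewrite (groupVr (G := Group _) Fb).
have Fh' := fhom_comp Fh (fusAut_fhom Fb').
have imh' : (b^-1 \o h) @: P = Q.
  apply/eqP; rewrite eqEcard; apply/andP; split.
    by apply/subsetP=> _ /imsetP[x Px ->]; have [_ _ -> //] := fhomP Fh'.
  rewrite card_in_imset; last by have [] := fhomP Fh'.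
  by rewrite -imh leq_imset_card.
have [|k Fk kh] := fhom_extend (D := 'N_S(P)%G) Fh' imh' cQ (subxx _).
  move=> t Nt; have [a Fa ah] := fhom_transport Fh imh Nt.
  exists (a ^ b^-1); last by move=> x Px; rewrite /= permJ ah.
  rewrite -mem_conjg; apply: (subsetP sDb); rewrite inE Fa /=.
  by apply/exists_inP; exists t => //; apply/forall_inP=> x Px; rewrite ah.
exists Q, k; split=> //; first exact: fhom_restr (joing_subl _ _) Fk.
by rewrite -imh'; apply: eq_in_imset.
Qed.
End Saturation.

(** * An abelian strongly closed subgroup is normal in the fusion system *)

Section StronglyClosed.

Variables (p : nat) (gT : finGroupType) (S : {group gT}) (F : fusion_system S).
Hypotheses (pS : p.-group S) (satF : saturated F p).
Variable A : {group gT}.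
Hypotheses (sAS : A \subset S) (cAA : abelian A).
Hypothesis sclA : forall (P : {group gT}) h,
  P \subset A -> fhom F P S h -> h @: P \subset A.
Implicit Types (P Q R : {group gT}) (h k : gT -> gT).

Let nAS : S \subset 'N(A).
Proof.
apply/subsetP=> g Sg; rewrite inE -[A :^ g]/(conjg^~ g @: A).
apply: sclA => //; apply: fhom_conj => //.
by rewrite -(conjGid Sg) conjSg.
Qed.

Let fhom_fixes P h : A \subset P -> fhom F P S h -> h @: A = A.
Proof.
move=> sAP Fh; apply/eqP; rewrite eqEcard.
rewrite sclA //=; last exact: fhom_restr Fh.
have [_ _ _ _ hI] := fhomP Fh.
by rewrite card_in_imset //; apply: sub_in2 hI; apply/subsetP.
Qed.

Let capA P h x : fhom F P S h -> x \in P -> x \in A -> h x \in A.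
Proof.
move=> Fh Px Ax; apply: (subsetP (sclA (P := P :&: A) (subsetIr _ _) _)) => //.
  exact: fhom_restr (subsetIl _ _) Fh.
by apply: imset_f; rewrite inE Px.
Qed.

Let fhom_S P Q h : fhom F P Q h -> fhom F P S h.
Proof.
move=> Fh; have [_ sQS hQ _ _] := fhomP Fh; apply: fhom_cod Fh (subxx _) _.
by apply/subsetP=> _ /imsetP[x Px ->]; apply: (subsetP sQS); apply: hQ.
Qed.

(* These automorphisms stabilize the series 1 <= Q :&: A <= Q, so they form a *)
(* normal p-subgroup of Aut_F(Q), whose Sylow subgroup is Aut_S(Q).           *)
Let stabilizer_sub_autS Q : Q \subset S -> fully_normalized F Q ->
  [set a in fusAut F Q | [forall x in Q, x^-1 * a x \in A]
                       & [forall x in Q :&: A, a x == x]] \subset autS S Q.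
Proof.
move=> sQS nQ; have [_ sylQ] := satF.1 _ sQS nQ.
set K := [set a in _ | _ & _].
pose AutQ := Group (fusAut_group_set F sQS).
have KP a : reflect [/\ a \in AutQ, {in Q, forall x, x^-1 * a x \in A}
                      & {in Q :&: A, forall x, a x = x}] (a \in K).
  apply: (iffP idP) => [|[Fa aA aV]].
    rewrite inE => /and3P[Fa /forall_inP aA /forall_inP aV].
    by split=> // x /aV/eqP.
  rewrite inE; apply/and3P; split=> //; first exact/forall_inP.
  by apply/forall_inP=> x /aV/eqP.
have aQ a x : a \in AutQ -> x \in Q -> a x \in Q.
  by move=> /fusAut_Aut Aa; apply: Aut_closed.
have aM a : a \in AutQ -> {in Q &, {morph a : x y / x * y}}.
  by move=> /fusAut_fhom Fa; have [] := fhomP Fa.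
have gK : group_set K.
  apply/group_setP; split=> [|a b /KP[Fa aA aV] /KP[Fb bA bV]]; apply/KP; split.
  - exact: group1.
  - by move=> x _; rewrite perm1 mulVg.
  - by move=> x _; rewrite perm1.
  - exact: groupM.
  - move=> x Qx; rewrite permM.
    have Vy : x^-1 * a x \in Q :&: A by rewrite inE aA // groupM ?groupV ?aQ.
    rewrite -[a x](mulKVg x) aM ?(subsetP (subsetIl _ _) _ Vy) // (bV _ Vy) mulgA.
    by rewrite groupM ?bA ?aA.
  - by move=> x VX; rewrite permM aV ?bV.
have pK : p.-group (Group gK).
  rewrite -pnat_exponent; apply: (pnat_dvd _ (pgroupS sAS pS)).
  apply/exponentP=> a /KP[Fa aA aV].
  (* Since [a] fixes [x^-1 * a x], which lies in [Q :&: A], its powers are explicit and its order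
     divides |A|. *)
  have aX n : {in Q, forall x, (a ^+ n) x = x * (x^-1 * a x) ^+ n}.
    elim: n => [|n IHn] x Qx; first by rewrite perm1 mulg1.
    have Vy : x^-1 * a x \in Q :&: A.
      by rewrite inE aA // groupM ?groupV ?aQ.
    rewrite expgSr permM IHn // aM ?groupX //; last by case/setIP: Vy.
    by rewrite (aV _ (groupX n Vy)) -{1}[a x](mulKVg x) -mulgA -expgS.
  apply: (@eq_Aut _ Q); rewrite ?group1 ?groupX ?(fusAut_Aut Fa) // => x Qx.
  rewrite aX //; have -> : (x^-1 * a x) ^+ #|A| = 1.
    by apply/eqP; rewrite -order_dvdn order_dvdG ?aA.
  by rewrite mulg1 perm1.
have nK : Group gK <| AutQ.
  apply/andP; split; first by apply/subsetP=> a /KP[].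
  apply/subsetP=> b Fb; rewrite inE; apply/subsetP=> _ /imsetP[a /KP[Fa aA aV] ->].
  have Fb' : b^-1 \in AutQ by rewrite groupV.
  have bS := fhom_S (fusAut_fhom Fb); have bS' := fhom_S (fusAut_fhom Fb').
  apply/KP; split; first by rewrite groupJ.
    move=> x Qx; rewrite conjgE !permM; set y := b^-1 x.
    have Qy : y \in Q by rewrite aQ.
    have -> : x = b y by rewrite permKV.
    have [f _ fb] := fhom_morphism bS.
    rewrite -fb -morphV // -morphM ?groupV ?aQ // fb.
    by apply: capA bS _ _; rewrite ?aA // groupM ?groupV ?aQ.
  move=> x /setIP[Qx Ax]; rewrite conjgE !permM aV ?permKV //.
  by rewrite inE aQ // (capA bS').
apply: subset_trans (pcore_max pK nK) _; exact: (pcore_sub_Hall (G := AutQ) sylQ).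
Qed.

(** Induction on |S| - |P|. Isomorphisms onto fully normalized subgroups are extended to N_A(P)P,
    which is larger than [P] unless [A <= P]. A general [h] is a quotient of two such
    isomorphisms. *)
Lemma strongly_closed_extend P h : fhom F P S h ->
  exists2 k, fhom F (P <*> A)%G S k & {in P, k =1 h}.
Proof.
have [n] := ubnP (#|S| - #|P|)%N; elim: n => // n IHn in P h *; rewrite ltnS => le_n Fh.
have [sPS _ hS hM hI] := fhomP Fh.
have step P1 Q k : fhom F P1 Q k -> k @: P1 = Q -> #|P1| = #|P| ->
    fully_normalized F Q ->
  exists2 k1, fhom F (P1 <*> A)%G S k1 & {in P1, k1 =1 k}.
  move=> Fk imk oP1 nQ; have [sP1S sQS kQ _ _] := fhomP Fk.
  have [sAP | nsAP] := boolP (A \subset P1).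
    exists k => //; have -> : (P1 <*> A)%G = P1.
      by apply/val_inj/joing_idPl.
    exact: fhom_S Fk.
  have [cQ _] := satF.1 _ sQS nQ.
  have FkS := fhom_S Fk.
  pose T := 'N_A(P1).
  have sTN : T \subset 'N_S(P1) by rewrite setSI.
  have [|k0 Fk0 k0k] := fhom_extend satF (D := T) Fk imk cQ sTN.
    (* Conjugation by [t] acts trivially on [P1 :&: A], as [A] is abelian, and modulo [A], as [A] is
       normal in [S]. Strong closure carries both properties over to [Q]. *)
    move=> t Tt; have [a Fa ak] := fhom_transport Fk imk (subsetP sTN t Tt).
    exists a; last by move=> x P1x; rewrite ak.
    apply: (subsetP (stabilizer_sub_autS sQS nQ)); rewrite inE Fa /=.
    have [R [l [defR _ _ Fl [kK lK]]]] := fhom_inv Fk.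
    have{defR} defR: R = Q by apply/val_inj; rewrite /= defR.
    rewrite {R}defR in Fl lK; have [_ _ lP _ _] := fhomP Fl.
    case/setIP: Tt => At Nt.
    apply/andP; split; apply/forall_inP=> y.
      move=> Qy; rewrite -[y]lK // ak ?lP //; set x := l y.
      have P1x : x \in P1 by apply: lP.
      have [f _ fk] := fhom_morphism FkS.
      have P1xt : x ^ t \in P1 by rewrite memJ_norm.
      rewrite -fk -morphV // -morphM ?groupV // fk; apply: capA FkS _ _.
        by rewrite groupM ?groupV.
      have nAx : x \in 'N(A) by apply: (subsetP nAS); apply: (subsetP sP1S).
      by rewrite -commgEl commgEr groupM // memJ_norm ?groupV.
    case/setIP=> Qy Ay; rewrite -[y]lK // ak ?lP //; set x := l y.
    have Ax : x \in A by apply: capA (fhom_S Fl) _ _.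
    by rewrite conjgE -(centsP cAA t At x Ax) mulKg.
  (* Normalizers grow in the p-group P1 A, and the normalizer of [P1] there is P1 N_A(P1). *)
  have ltP : (#|P1| < #|(T <*> P1)%G|)%N.
    rewrite proper_card // properE joing_subr join_subG subxx andbT.
    apply/negP => sTP.
    have pJ : p.-group (P1 <*> A) by rewrite (pgroupS _ pS) // join_subG sP1S.
    have := nilpotent_proper_norm (pgroup_nil pJ) (H := P1).
    rewrite properE joing_subl join_subG subxx /=.
    rewrite nsAP => /(_ isT)/proper_subn/negP[].
    rewrite (norm_joinEl (subset_trans sP1S nAS)) /=.
    by rewrite -group_modl ?normG // mul_subG.
  have [|k1 Fk1 k1k] := IHn (T <*> P1)%G k0 _ Fk0.
    apply: leq_trans le_n; rewrite -oP1; apply: ltn_sub2l => //.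
    apply: leq_trans ltP _; apply: subset_leq_card; have [] := fhomP Fk0; by [].
  exists k1; last first.
    by move=> x Px; rewrite k1k ?k0k // (subsetP (joing_subr _ _)).
  apply: fhom_restr Fk1.
  by rewrite join_subG joing_subr (subset_trans (joing_subr T P1) (joing_subl _ _)).
have [R [hi [defR sRS FhR Fhi [hK hiK]]]] := fhom_inv Fh.
have [Q [g [Fg img nQ]]] := exists_fully_normalized F sRS.
have oR : #|R| = #|P| by rewrite defR card_in_imset.
have [g1 Fg1 g1g] := step R Q g Fg img oR nQ.
have [|k1 Fk1 k1g] := step P Q (g \o h) (fhom_comp FhR Fg) _ erefl nQ.
  by rewrite imset_comp -defR.
(* The extension of [h] is the inverse of [g1] after [k1]. It is defined because [k1] maps [P] onto
   [Q] and both maps send [A] onto [A]. *)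
have [U [g2 [defU sUS Fg1U Fg2 [g1K g2K]]]] := fhom_inv Fg1.
have sJU : k1 @: (P <*> A) \subset U.
  apply: (fhom_joing Fk1); rewrite ?joing_subl ?joing_subr //.
    apply/subsetP=> _ /imsetP[x Px ->]; rewrite k1g // defU /= -(g1g (h x)).
      by apply: imset_f; rewrite (subsetP (joing_subl _ _)) // defR imset_f.
    by rewrite defR imset_f.
  rewrite (fhom_fixes (joing_subr _ _) Fk1) -(fhom_fixes (joing_subr _ _) Fg1) defU.
  by rewrite imsetS ?joing_subr.
exists (g2 \o k1).
  by apply: fhom_S (fhom_comp (fhom_cod Fk1 sUS sJU) Fg2).
move=> x Px /=; have Rhx : h x \in R by rewrite defR imset_f.
by rewrite k1g //= -g1g // g1K // (subsetP (joing_subl _ _)).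
Qed.

Lemma strongly_closed_normal : fus_normal F A.
Proof.
split=> // Q R f Ff; have Fh := mem_fhom Ff; have [_ sRS fR _ _] := fhomP Fh.
have [k Fk kf] := strongly_closed_extend (fhom_S Fh).
have imA := fhom_fixes (joing_subr _ _) Fk.
have sQJ : Q \subset (Q <*> A)%G by apply: joing_subl.
have sAJ : A \subset (Q <*> A)%G by apply: joing_subr.
exists (on_dom (Q <*> A)%G k).
  apply: fhom_cod (Fk) _ _; first by rewrite join_subG sRS.
  apply: (fhom_joing Fk) => //.
    apply/subsetP=> _ /imsetP[x Qx ->]; rewrite kf //.
    by rewrite (subsetP (joing_subl _ _)) ?fR.
  by rewrite imA joing_subr.
split=> [x Qx | ]; first by rewrite on_domE ?kf // (subsetP sQJ).
rewrite -[RHS]imA; apply: eq_in_imset => x Ax.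
by rewrite on_domE // (subsetP sAJ).
Qed.

End StronglyClosed.

(** * Counting with the commutator map of an element normalizing [A] *)

Section CommutatorMap.

Variables (gT : finGroupType) (A : {group gT}) (x : gT).
Hypotheses (cAA : abelian A) (nAx : x \in 'N(A)).

(** As [a, x] = a^-1 a^x, this is the map sending a to x(a) - a, written multiplicatively; its image
    on [A] is [A, x]. *)
Definition comm_by (a : gT) := [~ a, x].

Let comm_byA a : a \in A -> comm_by a \in A.
Proof. by move=> Aa; rewrite /comm_by commgEl groupM ?groupV ?memJ_norm. Qed.

Lemma comm_byM : {in A &, {morph comm_by : a b / a * b}}.
Proof.
move=> a b Aa Ab; rewrite /comm_by commMgJ; congr (_ * _).
have:= centsP cAA _ (comm_byA Aa) _ Ab; rewrite /comm_by => cab.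
by rewrite conjgE cab mulKg.
Qed.

Canonical comm_by_morphism := Morphism comm_byM.

(** Let I = C_A(x) :&: [A, x]. Then |I| |Z| = |IZ| |I :&: Z|, where IZ lies in C_A(x) and I :&: Z in
    [A, x] :&: Z. These are the kernel and the image of [comm_by] on the set on the right. *)
Lemma card_cent_comm_by (Z : {group gT}) : Z \subset 'C_A[x] ->
  (#|'C_A[x] :&: comm_by @: A| * #|Z| <= #|[set a in A | comm_by a \in Z]|)%N.
Proof.
move=> sZC; pose C := 'C_A[x]%G; pose k := comm_by_morphism.
have kerk : 'ker k = C.
  apply/setP=> a; apply/morphpreP/setIP=> [[Aa /set1P/eqP/commgP cax]|[Aa /cent1P cxa]].
    by split=> //; apply/cent1P/commute_sym.
  by split=> //; apply/set1P/eqP/commgP/commute_sym.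
pose Y := (k @*^-1 Z)%G.
have -> : [set a in A | comm_by a \in Z] = Y by apply/setP=> a; rewrite !inE.
have -> : comm_by @: A = k @* A by rewrite morphimEdom.
pose I := (C :&: k @* A)%G.
have -> : #|Y| = (#|C| * #|k @* Y|)%N.
  have sYA : Y \subset A by apply: subsetIl.
  have sCY : C \subset Y by rewrite -kerk morphpreS ?sub1G.
  by rewrite card_morphim (setIidPr sYA) kerk; apply/esym/Lagrange.
rewrite -[C :&: k @* A]/(gval I) mul_cardG leq_mul //.
  by rewrite subset_leq_card // mul_subG ?subsetIl.
rewrite subset_leq_card //; apply/subsetP=> y /setIP[/setIP[_ /morphimP[a Aa _ ->]] Za].
by rewrite mem_morphim // mem_morphpre.
Qed.

End CommutatorMap.

(** * Finding the subgroup [X] of [S] *)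

Section QuadraticSubgroup.

Variables (p : nat) (gT : finGroupType) (S : {group gT}) (F : fusion_system S).
Hypotheses (pS : p.-group S) (satF : saturated F p).
Variable A : {group gT}.
Hypotheses (sAS : A \subset S) (abelA : p.-abelem A).
Implicit Types (P Q R X : {group gT}) (h k : gT -> gT).

(* Here #|'C_A[x] :&: [A, x]| is p ^ J_A(x), and X / (X :&: A) is the image of *)
(* X in Aut_F(A) when A is its own centralizer in S.                          *)
Definition jordan_bound X := [/\ X \subset 'N_S(A), p.-abelem X, ~~ (X \subset A)
  & {in X, forall x, x \notin A ->
      #|'C_A[x] :&: comm_by x @: A| * #|X :&: A| <= #|X|}%N].

Let cAA : abelian A := abelem_abelian abelA.

Let sub_cent1 X x : abelian X -> x \in X -> X :&: A \subset 'C_A[x].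
Proof.
move=> cXX Xx; rewrite setIC setIS // (subset_trans cXX) //.
by rewrite -cent_set1 centS ?sub1set.
Qed.

(** By [card_cent_comm_by] with [Z = E :&: A], the product to be bounded is at most the order of a
    subset of [A], and |A| = |E|. *)
Lemma jordan_bound_same_order (E : {group gT}) : E \subset 'N_S(A) -> p.-abelem E ->
  #|E| = #|A| -> E != A -> jordan_bound E.
Proof.
move=> sEN abelE oE neEA; split=> // [|x Ex _].
  by apply: contra neEA => sEA; rewrite -val_eqE eqEcard sEA oE /=.
have nAx : x \in 'N(A) by case/setIP: (subsetP sEN x Ex).
apply: leq_trans (card_cent_comm_by cAA nAx _) _.
  exact: sub_cent1 (abelem_abelian abelE) Ex.
by rewrite oE subset_leq_card // setIdE subsetIl.
Qed.

Hypothesis lone : forall E : {group gT},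
  E \subset 'N_S(A) -> p.-abelem E -> #|E| = #|A| -> E = A.

(** Otherwise some [g] outside N_S(A) normalizes N_S(A), and A^g is a second subgroup of the kind
    that [lone] excludes. *)
Let nAS : S \subset 'N(A).
Proof.
apply/negPn/negP=> nsN.
have prN : 'N_S(A) \proper S by rewrite properE subsetIl subsetI subxx.
have /properP[_ [g]] := nilpotent_proper_norm (pgroup_nil pS) prN.
case/setIP=> Sg /normP nNg /negP[]; rewrite inE Sg.
apply/normP; apply: (congr1 val (x := (A :^ g)%G)); apply: lone.
- by rewrite -nNg conjSg subsetI sAS normG.
- by rewrite abelemJ.
- exact: cardJg.
Qed.

Let fhom_fixes P h : A \subset P -> fhom F P S h -> h @: A = A.
Proof.
move=> sAP Fh; have [R [k [defR sRS Fh' _ _]]] := fhom_inv (fhom_restr sAP Fh).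
have [f injf fh] := fhom_morphism Fh'; have [_ _ _ _ hI] := fhomP Fh'.
rewrite -defR; congr (gval _); apply: lone.
- by rewrite (setIidPl nAS).
- have -> : R = (f @* A)%G by apply/val_inj; rewrite /= morphimEdom fh.
  by rewrite injm_abelem.
- by rewrite defR card_in_imset.
Qed.

(** The map extends to C_S(P)P, which contains the abelian group [A], and the extension preserves
    [A]. *)
Let sub_A_of_fully_centralized P Q h : P \subset A -> fhom F P Q h -> h @: P = Q ->
  fully_centralized F Q -> Q \subset A.
Proof.
move=> sPA Fh imh cQ; have [k Fk kh] := fhom_extend_cent satF Fh imh cQ.
rewrite -(fhom_fixes _ Fk); last first.
  apply: subset_trans (joing_subl _ _).
  by rewrite subsetI sAS (subset_trans cAA) ?centS.
by rewrite -imh -(eq_in_imset kh) imsetS.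
Qed.

(** Such an [X] witnesses that [A] is not strongly closed. *)
Definition fused X := [&& X \subset S, ~~ (X \subset A) & [exists f, f \in F X A]].

Let fused_fhom X h : fhom F X A h -> ~~ (X \subset A) -> fused X.
Proof.
move=> Fh nsXA; have [sXS _ _ _ _] := fhomP Fh; apply/and3P; split=> //.
by apply/existsP; exists (on_dom X h).
Qed.

Let fused_image P Q h : fhom F P Q h -> (exists k, fhom F P A k) ->
  exists R : {group gT}, [/\ R = h @: P :> {set gT}, #|R| = #|P|
    & ~~ (R \subset A) -> fused R].
Proof.
move=> Fh [k Fk]; have [R [l [defR _ _ Fl _]]] := fhom_inv Fh.
exists R; split=> //; last exact: fused_fhom (fhom_comp Fl Fk).
by rewrite defR card_in_imset //; case: (fhomP Fh).
Qed.

Let fused_abelem X : fused X -> p.-abelem X.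
Proof.
move=> /and3P[sXS nsXA /existsP[f0 /mem_fhom Ff]].
have [_ _ fA _ _] := fhomP Ff; have [f injf ff0] := fhom_morphism Ff.
rewrite -(injm_abelem injf) //; apply: abelemS abelA; rewrite /= morphimEdom ff0.
by apply/subsetP=> _ /imsetP[x Xx ->]; apply: fA.
Qed.

Lemma jordan_bound_fused : (exists X, fused X) -> exists X, jordan_bound X.
Proof.
case=> X0 fX0; have [X1 fX1 max1] := @arg_maxnP _ X0 fused (fun X => #|X :&: A|) fX0.
(* The choice is lexicographic: |X :&: A| is made maximal, and then |X|. *)
pose top X := fused X && (#|X :&: A| == #|X1 :&: A|).
have [|X /andP[fX /eqP oX1] max2] := @arg_maxnP _ X1 top (fun X => #|X|).
  by rewrite /top fX1 /=.
have maxZ R : fused R -> (#|R :&: A| <= #|X :&: A|)%N.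
  by move=> fR; rewrite oX1; apply: max1.
have maxX R : fused R -> (#|X :&: A| <= #|R :&: A| -> #|R| <= #|X|)%N.
  move=> fR leXR; apply: max2; rewrite /top fR /= eqn_leq -oX1 leXR.
  by rewrite maxZ.
have abelX := fused_abelem fX; have cXX := abelem_abelian abelX.
have /and3P[sXS nsXA /existsP[f0 /mem_fhom Ff]] := fX.
exists X; split=> // [|x Xx nAx]; first by rewrite (setIidPl nAS).
have [sxS nAx'] : x \in S /\ x \in 'N(A) by rewrite !(subsetP sXS, subsetP nAS).
set Z := X :&: A.
apply: leq_trans (card_cent_comm_by cAA nAx' (sub_cent1 cXX Xx)) _.
pose k := comm_by_morphism cAA nAx'.
have defY : [set a in A | comm_by x a \in X :&: A] = (k @*^-1 (X :&: A))%G.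
  by apply/setP=> a; rewrite !inE.
rewrite {}defY; set Y := (k @*^-1 (X :&: A))%G.
have YP a : reflect (a \in A /\ [~ a, x] \in Z) (a \in Y).
  by apply: (iffP morphpreP) => [[]|[]].
have sYA : Y \subset A by apply/subsetP=> a /YP[].
have sZY : Z \subset Y.
  apply/subsetP=> z /setIP[Xz Az]; apply/YP; split=> //.
  by have /eqP -> : [~ z, x] == 1 by apply/commgP/(centsP cXX).
pose P := ((X :&: A) <*> <[x]>)%G.
have sZP : Z \subset P by apply: joing_subl.
have Px : x \in P by rewrite (subsetP (joing_subr _ _)) ?cycle_id.
have sPX : P \subset X by rewrite join_subG subsetIl cycle_subG.
have sPS := subset_trans sPX sXS.
have ltZP : (#|Z| < #|P|)%N.
  rewrite proper_card // properE sZP; apply: contra nAx => /subsetP/(_ x Px).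
  by case/setIP.
have sXN : X \subset 'N_S(P).
  by rewrite subsetI sXS (subset_trans cXX) // (subset_trans (centS sPX)) ?cent_sub.
have sYN : Y \subset 'N_S(P).
  rewrite subsetI (subset_trans sYA sAS) /=; apply/subsetP=> a /YP[Aa Zax].
  rewrite inE /= conjYg join_subG; apply/andP; split; last first.
    rewrite -cycleJ cycle_subG conjg_mulR groupM //.
    by rewrite -invg_comm groupV (subsetP sZP).
  apply/subsetP=> _ /imsetP[z Zz ->].
  rewrite conjgE (centsP cAA z _ a Aa) ?mulKg ?(subsetP sZP) //.
  by case/setIP: Zz.
(* It remains to show |Y| <= |X|. Both groups normalize [P], so [h] is defined on both. *)
have [Q [h [Fh imh nQ]]] := normalizer_extend pS satF sPS.
have sPN : P \subset 'N_S(P) by rewrite subsetI sPS normG.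
have sQS : Q \subset S.
  rewrite -imh; apply/subsetP=> _ /imsetP[y Py ->].
  by have [_ _ -> //] := fhomP Fh; apply: (subsetP sPN).
have [cQ _] := satF.1 _ sQS nQ.
have sQA : Q \subset A.
  have [R [l [defR sRA _ Fl [f0K lK]]]] := fhom_inv (fhom_restr sPX Ff).
  have Fhl := fhom_comp Fl (fhom_restr sPN Fh).
  have iml : l @: R = P.
    apply/setP=> y; apply/imsetP/idP=> [[z Rz ->]|Py].
      by have [_ _ ->] := fhomP Fl.
    by exists (f0 y); rewrite ?f0K // defR imset_f.
  have imhl : (h \o l) @: R = Q by rewrite imset_comp iml.
  apply: (sub_A_of_fully_centralized sRA (fhom_cod Fhl sQS _) imhl cQ).
  by rewrite imhl.
have oQ : #|Q| = #|P|.
  rewrite -imh card_in_imset //.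
  by have [_ _ _ _ hI] := fhomP Fh; apply: sub_in2 hI; apply/subsetP.
(* Otherwise the image of [X] is fused and meets [A] in at least [Q], of order |P| > |Z|, against
   the choice of [X]. *)
have hXA : h @: X \subset A.
  have [|R [defR _ fR]] := fused_image (fhom_restr sXN Fh); first by exists f0.
  rewrite -defR; apply/negPn/negP=> /fR/maxZ; rewrite leqNgt => /negP[].
  apply: leq_trans ltZP _; rewrite -oQ subset_leq_card // subsetI sQA andbT.
  by rewrite defR -imh imsetS.
(* If [h] maps [Y] into [A], then the join of [X] and [Y] is fused and maximality gives |Y| <= |Z|.
   Otherwise the image of [Y] is fused and meets [A] in at least the image of [Z], so the second
   maximality applies. *)
have [hYA | nhYA] := boolP (h @: Y \subset A).
  have sLN : (X <*> Y)%G \subset 'N_S(P) by rewrite join_subG sXN.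
  have FhL : fhom F (X <*> Y)%G A h.
    exact: fhom_cod (fhom_restr sLN Fh) sAS (fhom_joing Fh sXN sYN hXA hYA).
  have fL : fused (X <*> Y)%G.
    by apply: fused_fhom FhL _; rewrite join_subG negb_and nsXA.
  apply: (@leq_trans #|Z|); last by rewrite subset_leq_card ?subsetIl.
  apply: leq_trans (maxZ _ fL); rewrite subset_leq_card // subsetI sYA andbT.
  exact: joing_subr.
have [|R [defR <- fR]] := fused_image (fhom_restr sYN Fh).
  by exists id; apply: fhom_id.
apply: maxX; first by apply: fR; rewrite defR.
have <- : #|h @: Z| = #|Z|.
  apply: card_in_imset; have [_ _ _ _ hI] := fhomP Fh; apply: sub_in2 hI.
  by apply/subsetP; apply: subset_trans sZP sPN.
rewrite subset_leq_card // subsetI defR imsetS //=.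
by apply: subset_trans sQA; rewrite -imh imsetS.
Qed.

(** The image of a subgroup of [A] is mapped back into [A] by the inverse morphism, so without fused
    subgroups [A] is strongly closed. *)
Lemma exists_fused : ~ fus_normal F A -> exists X, fused X.
Proof.
move=> nnA; have [/existsP //|/existsPn nf] := boolP [exists X, fused X].
case: nnA; apply: (strongly_closed_normal pS satF) => // P h sPA Fh.
have [|R [<- _ fR]] := fused_image Fh; first by exists id; apply: fhom_id.
by apply/negPn/negP=> /fR; apply/negP/nf.
Qed.

End QuadraticSubgroup.

Lemma exists_jordan_bound (p : nat) (gT : finGroupType)
    (S : {group gT}) (F : fusion_system S) (A : {group gT}) :
    p.-group S -> saturated F p -> A \subset S -> p.-abelem A ->
    ~ fus_normal F A ->
  exists X, jordan_bound p S A X.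
Proof.
move=> pS satF sAS abelA nnA.
pose alike (E : {group gT}) := [&& E \subset 'N_S(A), p.-abelem E & #|E| == #|A|].
have [/existsP[E /andP[/and3P[sEN abelE /eqP oE] neEA]] | /existsPn noE] :=
    boolP [exists E : {group gT}, alike E && (E != A)].
  by exists E; apply: jordan_bound_same_order.
apply: (jordan_bound_fused pS satF sAS abelA) => [E sEN abelE oE|].
  by have:= noE E; rewrite /alike sEN abelE oE eqxx /= => /negPn/eqP.
exact: (exists_fused pS satF sAS abelA).
Qed.

(** * From subgroups of [S] back to the module *)

Lemma autS_sub_fusAut (gT : finGroupType) (S : {group gT}) (F : fusion_system S)
    (P : {group gT}) : P \subset S -> autS S P \subset fusAut F P.
Proof.
move=> sPS; apply/subsetP=> _ /morphimP[g Ng /setIP[Sg _] ->].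
rewrite inE (subsetP (Aut_conj_aut P 'N(P))) ?mem_morphim //=.
apply: (@eq_fhom _ _ F P P (conjg^~ g)) => [x Px|].
  by rewrite norm_conj_autE.
by apply: fhom_conj; rewrite ?(normP Ng).
Qed.

(** A subspace of rank r over F_p has p^r vectors, and [chi] embeds the fixed vectors of the form w
    t - w into C_A(x) :&: [A, x]. *)
Lemma expn_jordan_blocks_le (p n : nat) (p_pr : prime p) (aT gT : finGroupType)
    (G : {group aT}) (rG : mx_representation 'F_p G n)
    (A : {group gT}) (phi : {morphism G >-> {perm gT}})
    (chi : {morphism [set: 'rV['F_p]_n] >-> gT}) t x :
  isom [set: 'rV['F_p]_n] A chi ->
  {in [set: 'rV['F_p]_n] & G, morph_act ('MR rG) 'P chi phi} ->
  t \in G -> x \in 'N(A) -> phi t = conj_aut A x -> abelian A ->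
  (p ^ jordan_blocks rG t <= #|'C_A[x] :&: comm_by x @: A|)%N.
Proof.
move=> /isomP[injchi imchi] chi_act Gt nAx phit cAA.
have chiA v : chi v \in A by rewrite -imchi mem_morphim ?inE.
have chiJ v : chi (v *m rG t)%R = chi v ^ x.
  rewrite -(norm_conj_autE nAx (chiA v)) -phit -[RHS]/('P (chi v) (phi t))%act.
  by rewrite -chi_act ?inE //= mx_repr_actE.
rewrite -{1}(card_Fp p_pr) -card_rowg -(card_in_imset (f := chi)); last first.
  by move=> u v _ _; apply: (injmP injchi); rewrite inE.
apply: subset_leq_card; apply/subsetP=> _ /imsetP[v + ->].
rewrite inE sub_capmx => /andP[/rfix_mxP vt /submxP[w def_v]].
apply/setIP; split.
  rewrite inE chiA /=; apply/cent1P/commgP/conjg_fixP.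
  by rewrite -chiJ vt ?set11.
apply/imsetP; exists (chi w) => //.
have -> : v = (w *m rG t)%R * w^-1.
  by rewrite def_v mulmxBr mulmx1.
rewrite morphM ?morphV ?inE // chiJ /comm_by commgEl.
by rewrite (centsP cAA _ _ _ (groupVr (chiA w))) // memJ_norm.
Qed.

Theorem corollary2p9 (p : nat) (p_prime : prime p)
    (aT : finGroupType) (G : {group aT})
    (G_resid : G :=: pprime_residual p G)
    (n : nat) (rG : mx_representation 'F_p G n) (rG_faithful : mx_faithful rG)
    (realizable : exists (gT : finGroupType) (S : {group gT})
        (F : fusion_system S),
      [/\ p.-group S, saturated F p & realizes F ('MR rG)%gact]) :
  exists (m : nat) (B : {group aT}),
    [/\ (1 <= m)%N, B \in 'E_p^m(G)
      & forall t : aT, t \in B -> t != 1 -> (jordan_blocks rG t <= m)%N].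
Proof.
have [gT [S [F [pS satF [A [sAS cAA cSA nnA [phi [chi [isoG isoA act]]]]]]]]] :=
  realizable.
have [injphi imphi] := isomP (H := Group (fusAut_group_set F sAS)) isoG.
have [injchi imchi] := isomP isoA.
have abelA : p.-abelem A.
  by rewrite -imchi injm_abelem // mx_Fp_abelem.
have [X [sXN abelX nsXA boundX]] :=
  exists_jordan_bound pS satF sAS abelA nnA.
have [sXS nAX] : X \subset S /\ X \subset 'N(A).
  by apply/andP; rewrite -subsetI.
pose B := (phi @*^-1 (conj_aut A @* X))%G.
have imB : phi @* B = conj_aut A @* X.
  by rewrite morphpreK // imphi (subset_trans _ (autS_sub_fusAut F sAS)) // morphimS.
have sBG : B \subset G by apply: subsetIl.
have abelB : p.-abelem B.
  by rewrite -(injm_abelem injphi) // /= imB morphim_abelem.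
have kerX : X :&: 'C(A) = X :&: A.
  by rewrite -{2}cSA setIA (setIidPl sXS).
(* The kernel of the action of [X] on [A] is [X :&: A], because [A] is its own centralizer in
   [S]. *)
have oB : (#|B| * #|X :&: A| = #|X|)%N.
  rewrite -(card_injm injphi sBG) imB card_morphim (setIidPr nAX) ker_conj_aut.
  by rewrite -indexgI kerX mulnC Lagrange ?subsetIl.
have oBm := card_pgroup (abelem_pgroup abelB).
exists (logn p #|B|), B; split.
- rewrite lt0n; apply: contraNneq nsXA => m0.
  have oX : #|X :&: A| = #|X| by rewrite -oB oBm m0 mul1n.
  by apply/setIidPl/eqP; rewrite eqEcard subsetIl oX /=.
- exact/pnElemP.
move=> t /morphpreP[Gt /morphimP[x nAx Xx phit]] nt_t.
(* An element of the abelian group [A] would act trivially on it, forcing [t = 1] as [phi] is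
   injective. *)
have nxA : x \notin A.
  apply: contra nt_t => Ax; rewrite -(morph_injm_eq1 injphi) // phit.
  by apply/eqP/mker; rewrite ker_conj_aut (subsetP cAA).
rewrite -(leq_exp2l _ _ (prime_gt1 p_prime)) -oBm.
rewrite -(leq_pmul2r (cardG_gt0 (X :&: A))) oB.
apply: leq_trans (boundX x Xx nxA); rewrite leq_mul2r.
by rewrite (expn_jordan_blocks_le p_prime isoA act Gt nAx phit cAA) orbT.
Qed.
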